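(* In Stewart's gauge, the evolution system for the unknowns $\mathbf e=(C^{\mathcal A},P^{\mathcal A},Q)$, $\mathbf\Gamma=(\epsilon,\pi,\beta,\mu,\alpha,\lambda,\tau,\sigma,\rho)$ and $\mathbf\Psi=(\Psi_0,\Psi_1,\Psi_2,\Psi_3,\Psi_4)$ implied by the vacuum Newman–Penrose field equations, namely $\boldsymbol{\mathcal D}_1\mathbf e=\mathbf B_1\mathbf e$, $\boldsymbol{\mathcal D}_2\mathbf\Gamma=\mathbf B_2\mathbf\Gamma$, $\boldsymbol{\mathcal D}_3\mathbf\Psi=\mathbf B_3\mathbf\Psi$ as written out in the context, is symmetric hyperbolic with respect to the direction given by $\tau^a=l^a+n^a$. That is, writing $\boldsymbol{\mathcal D}_i=\mathbf A_i^\mu\partial_\mu$, the matrices $\mathbf A_i^\mu$ are Hermitian and $\mathbf A_i^\mu(l_\mu+n_\mu)$ is positive definite.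
   Context: Stewart's gauge: coordinates $(v,u,x^{\mathcal A})$, $\mathcal A=2,3$, and a Newman–Penrose tetrad $l=\partial_v+C^{\mathcal A}\partial_{\mathcal A}$, $n=Q\partial_u$, $m=P^{\mathcal A}\partial_{\mathcal A}$, $\bar m$ on a vacuum spacetime of signature $(+---)$, with $g(l,n)=1$, $g(m,\bar m)=-1$, all other products zero, $n_\mu\mathrm dx^\mu=\mathrm dv$, $l_\mu\mathrm dx^\mu=Q^{-1}\mathrm du$; $Q,C^{\mathcal A}$ are real, $P^{\mathcal A}$ complex. As differential operators on scalars $D=\partial_v+C^{\mathcal A}\partial_{\mathcal A}$, $\Delta=Q\partial_u$, $\delta=P^{\mathcal A}\partial_{\mathcal A}$, $\bar\delta=\bar P^{\mathcal A}\partial_{\mathcal A}$. The spin coefficients satisfy $\kappa=\nu=\gamma=0$, $\rho=\bar\rho$, $\mu=\bar\mu$, $\pi=\alpha+\bar\beta$. The operators are $\boldsymbol{\mathcal D}_1=\mathrm{diag}(\Delta,\Delta,D)$, $\boldsymbol{\mathcal D}_2=\mathrm{diag}(\Delta,\Delta,\Delta,\Delta,\Delta,\Delta,D,D,D)$, $$\boldsymbol{\mathcal D}_3=\begin{pmatrix}\Delta&-\delta&0&0&0\\-\bar\delta&D+\Delta&-\delta&0&0\\0&-\bar\delta&D+\Delta&-\delta&0\\0&0&-\bar\delta&D+\Delta&-\delta\\0&0&0&-\bar\delta&D\end{pmatrix}.$$ The right-hand sides contain no derivatives of the unknowns. Explicitly, the equations are: Frame: $\Delta C^{\mathcal A}=-(\bar\tau+\pi)P^{\mathcal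 A}-(\tau+\bar\pi)\bar P^{\mathcal A}$; $\Delta P^{\mathcal A}=-\mu P^{\mathcal A}-\bar\lambda\bar P^{\mathcal A}$; $DQ=-(\epsilon+\bar\epsilon)Q$. Connection: $\Delta\epsilon=-\Psi_2-\beta\pi-\alpha\bar\pi-\alpha\tau-\pi\tau-\beta\bar\tau$; $\Delta\pi=-\Psi_3-\mu\pi-\lambda\bar\pi-\lambda\tau-\mu\bar\tau$; $\Delta\beta=-\alpha\bar\lambda-\beta\mu-\mu\tau$; $\Delta\mu=-\lambda\bar\lambda-\mu^2$; $\Delta\alpha=-\Psi_3-\beta\lambda-\alpha\mu-\lambda\tau$; $\Delta\lambda=-\Psi_4-2\lambda\mu$; $D\tau=\Psi_1+\bar\pi\rho+\pi\sigma+(\epsilon-\bar\epsilon+\rho)\tau+\sigma\bar\tau$; $D\sigma=\Psi_0+(3\epsilon-\bar\epsilon+2\rho)\sigma$; $D\rho=(\epsilon+\bar\epsilon)\rho+\rho^2+\sigma\bar\sigma$. Weyl tensor: $\Delta\Psi_0-\delta\Psi_1=-\mu\Psi_0-2(2\tau+\beta)\Psi_1+3\sigma\Psi_2$; $(D+\Delta)\Psi_1-\bar\delta\Psi_0-\delta\Psi_2=(\pi-4\alpha)\Psi_0+2(2\rho+\epsilon-\mu)\Psi_1-3\tau\Psi_2+2\sigma\Psi_3$; $(D+\Delta)\Psi_2-\bar\delta\Psi_1-\delta\Psi_3=-\lambda\Psi_0+2(\pi-\alpha)\Psi_1+3(\rho-\mu)\Psi_2+2(\beta-\tau)\Psi_3+\sigma\Psi_4$;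 $(D+\Delta)\Psi_3-\bar\delta\Psi_2-\delta\Psi_4=-2\lambda\Psi_1+3\pi\Psi_2+2(\rho-\epsilon-2\mu)\Psi_3+(4\beta-\tau)\Psi_4$; $D\Psi_4-\bar\delta\Psi_3=-3\lambda\Psi_2+2(2\pi+\alpha)\Psi_3+(\rho-4\epsilon)\Psi_4$. *)

(* Defs.v *)
From HB Require Import structures.
From mathcomp Require Import all_boot all_order all_algebra.
From mathcomp Require Import complex.
From mathcomp Require Import all_classical all_reals all_analysis.
Set Implicit Arguments.
Unset Strict Implicit.
Unset Printing Implicit Defensive.
Import Order.TTheory GRing.Theory Num.Theory.
Import numFieldNormedType.Exports.
Local Open Scope classical_set_scope.
Local Open Scope complex_scope.
Local Open Scope ring_scope.

(* Points are the coordinate vectors (v, u, x^2, x^3), numbered 0, 1, 2, 3. *)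
Notation coords R := 'rV[R]_4.

Section Calculus.
Variable R : realType.

(* R[i] carries no R-normed-module structure, hence the componentwise
   definitions of partial derivatives and differentiability. *)
Definition pd (mu : 'I_4) (f : coords R -> R[i]) (x : coords R) : R[i] :=
  ('D_(delta_mx 0 mu) (fun y => complex.Re (f y)) x)
    +i* ('D_(delta_mx 0 mu) (fun y => complex.Im (f y)) x).

Definition cdifferentiable (f : coords R -> R[i]) (x : coords R) : Prop :=
  differentiable (fun y => complex.Re (f y)) x /\
  differentiable (fun y => complex.Im (f y)) x.

(* A (complex) tangent vector X^mu at a point is identified with the
   first-order operator X^mu d_mu. *)
Definition dd (X : 'rV[R[i]]_4) (f : coords R -> R[i]) (x : coords R) : R[i] :=
  \sum_mu X 0 mu * pd mu f x.

Definition lie_bracket (X Y : coords R -> 'rV[R[i]]_4) (x : coords R) :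
    'rV[R[i]]_4 :=
  \row_nu (dd (X x) (fun y => Y y 0 nu) x - dd (Y x) (fun y => X y 0 nu) x).

Definition conjv (X : 'rV[R[i]]_4) : 'rV[R[i]]_4 := map_mx (@conjc R) X.

(* At a point, an n x n matrix of first-order operators M_jk = M_jk^mu d_mu. *)
Definition opmx n := 'M['rV[R[i]]_4]_n.

Definition opact n (M : opmx n) (w : coords R -> 'cV[R[i]]_n) (x : coords R) :
    'cV[R[i]]_n :=
  \col_j \sum_k dd (M j k) (fun y => w y k 0) x.

Definition coefmx n (M : opmx n) (mu : 'I_4) : 'M[R[i]]_n :=
  \matrix_(j, k) M j k 0 mu.

Lemma opactE n (M : opmx n) (w : coords R -> 'cV[R[i]]_n) (x : coords R) :
  opact M w x =
  \sum_mu coefmx M mu *m \col_k pd mu (fun y => w y k 0) x.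
Proof.
apply/matrixP => j k; rewrite !mxE summxE exchange_big /=.
by apply: eq_bigr => mu _; rewrite !mxE; apply: eq_bigr => i _; rewrite !mxE.
Qed.

Definition positive_definite n (A : 'M[R[i]]_n) : Prop :=
  forall z : 'cV[R[i]]_n, z != 0 ->
    0 < (map_mx (@conjc R) z^T *m A *m z) 0 0.

(* For a system M w = B with B free of derivatives of the unknowns; t is the
   covector of the direction. *)
Definition symmetric_hyperbolic n (M : opmx n) (t : 'rV[R[i]]_4) : Prop :=
  (forall mu, coefmx M mu \is hermsymmx) /\
  positive_definite (\sum_mu t 0 mu *: coefmx M mu).

End Calculus.

(* C^A and P^A for A = 2, 3 are indexed by 'I_2. *)
Record frame (R : realType) := Frame
  { fC : 'I_2 -> R; fP : 'I_2 -> R[i]; fQ : R }.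

Record spin (R : realType) := Spin
  { sc_kappa : R[i]; sc_sigma : R[i]; sc_rho : R[i]; sc_tau : R[i];
    sc_epsilon : R[i]; sc_beta : R[i]; sc_gamma : R[i]; sc_alpha : R[i];
    sc_pi : R[i]; sc_mu : R[i]; sc_lambda : R[i]; sc_nu : R[i] }.

Record weyl (R : realType) := Weyl
  { Psi0 : R[i]; Psi1 : R[i]; Psi2 : R[i]; Psi3 : R[i]; Psi4 : R[i] }.

Section StewartGauge.
Variable R : realType.
Implicit Types (f : frame R) (U : set (coords R)).
Implicit Types (e : coords R -> frame R) (G : coords R -> spin R).
Implicit Types (W : coords R -> weyl R) (x : coords R).

Definition vec_l f : 'rV[R[i]]_4 :=
  \row_(mu < 4) [:: 1; 0; (fC f 0)%:C; (fC f 1)%:C]`_mu.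
Definition vec_n f : 'rV[R[i]]_4 := \row_(mu < 4) [:: 0; (fQ f)%:C; 0; 0]`_mu.
Definition vec_m f : 'rV[R[i]]_4 :=
  \row_(mu < 4) [:: 0; 0; fP f 0; fP f 1]`_mu.
Definition vec_mb f : 'rV[R[i]]_4 := conjv (vec_m f).

Definition lower (h : 'M[R]_4) (X : 'rV[R[i]]_4) : 'rV[R[i]]_4 :=
  \row_mu \sum_nu (h mu nu)%:C * X 0 nu.

Definition gprod (h : 'M[R]_4) (X Y : 'rV[R[i]]_4) : R[i] :=
  \sum_mu lower h X 0 mu * Y 0 mu.

Record stewart_tetrad (h : 'M[R]_4) f : Prop := StewartTetrad
  { metric_sym : h^T = h;
    g_ln : gprod h (vec_l f) (vec_n f) = 1;
    g_mmb : gprod h (vec_m f) (vec_mb f) = -1;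
    g_ll : gprod h (vec_l f) (vec_l f) = 0;
    g_nn : gprod h (vec_n f) (vec_n f) = 0;
    g_mm : gprod h (vec_m f) (vec_m f) = 0;
    g_mbmb : gprod h (vec_mb f) (vec_mb f) = 0;
    g_lm : gprod h (vec_l f) (vec_m f) = 0;
    g_lmb : gprod h (vec_l f) (vec_mb f) = 0;
    g_nm : gprod h (vec_n f) (vec_m f) = 0;
    g_nmb : gprod h (vec_n f) (vec_mb f) = 0;
    n_form : lower h (vec_n f) = delta_mx 0 0;
    l_form : lower h (vec_l f) = (fQ f)^-1%:C *: delta_mx 0 1 }.

Record spin_gauge (s : spin R) : Prop := SpinGauge
  { kappa0 : sc_kappa s = 0;
    nu0 : sc_nu s = 0;
    gamma0 : sc_gamma s = 0;
    rho_real : sc_rho s = (sc_rho s)^*;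
    mu_real : sc_mu s = (sc_mu s)^*;
    pi_eq : sc_pi s = sc_alpha s + (sc_beta s)^* }.

Definition frame_seq f :=
  [:: (fC f 0)%:C; (fC f 1)%:C; fP f 0; fP f 1; (fQ f)%:C].
Definition spin_seq (s : spin R) :=
  [:: sc_kappa s; sc_sigma s; sc_rho s; sc_tau s; sc_epsilon s; sc_beta s;
      sc_gamma s; sc_alpha s; sc_pi s; sc_mu s; sc_lambda s; sc_nu s].
Definition weyl_seq (w : weyl R) := [:: Psi0 w; Psi1 w; Psi2 w; Psi3 w; Psi4 w].

Record stewart_gauge U (g : coords R -> 'M[R]_4) e G W : Prop := StewartGauge
  { gauge_tetrad : forall x, U x -> stewart_tetrad (g x) (e x);
    gauge_spin : forall x, U x -> spin_gauge (G x);
    frame_diff : forall x (i : nat), U x ->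
      cdifferentiable (fun y => (frame_seq (e y))`_i) x;
    spin_diff : forall x (i : nat), U x ->
      cdifferentiable (fun y => (spin_seq (G y))`_i) x;
    weyl_diff : forall x (i : nat), U x ->
      cdifferentiable (fun y => (weyl_seq (W y))`_i) x }.

(* The Newman-Penrose equations below are the general ones, for an arbitrary
   null tetrad in signature (+ - - -), with vanishing Ricci curvature. *)

(* Absence of torsion; these equations determine the twelve spin coefficients
   from the tetrad. *)
Definition np_commutators e G x : Prop :=
  let l := fun y => vec_l (e y) in
  let n := fun y => vec_n (e y) in
  let m := fun y => vec_m (e y) in
  let mb := fun y => vec_mb (e y) in
  let: Spin ka si ro ta ep be ga al pi mu la nu := G x in
  [/\ lie_bracket n l x =
        (ga + ga^*) *: l x + (ep + ep^*) *: n x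
        - (ta^* + pi) *: m x - (ta + pi^*) *: mb x,
      lie_bracket m l x =
        (al^* + be - pi^*) *: l x + ka *: n x
        - (ro^* + ep - ep^*) *: m x - si *: mb x,
      lie_bracket m n x =
        - nu^* *: l x + (ta - al^* - be) *: n x
        + (mu - ga + ga^*) *: m x + la^* *: mb x &
      lie_bracket mb m x =
        (mu^* - mu) *: l x + (ro^* - ro) *: n x
        + (al - be^*) *: m x - (al^* - be) *: mb x].

Definition np_ricci e G W x : Prop :=
  let D s := dd (vec_l (e x)) (fun y => s (G y)) x in
  let Del s := dd (vec_n (e x)) (fun y => s (G y)) x in
  let del s := dd (vec_m (e x)) (fun y => s (G y)) x in
  let delb s := dd (vec_mb (e x)) (fun y => s (G y)) x in
  let: Spin ka si ro ta ep be ga al pi mu la nu := G x in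
  let: Weyl p0 p1 p2 p3 p4 := W x in
     D (@sc_rho R) - delb (@sc_kappa R) =
       (ro ^+ 2 + si * si^*) + (ep + ep^*) * ro - ka^* * ta
       - ka * (3 * al + be^* - pi)
  /\ D (@sc_sigma R) - del (@sc_kappa R) =
       (ro + ro^*) * si + (3 * ep - ep^*) * si
       - (ta - pi^* + al^* + 3 * be) * ka + p0
  /\ D (@sc_tau R) - Del (@sc_kappa R) =
       (ta + pi^*) * ro + (ta^* + pi) * si + (ep - ep^*) * ta
       - (3 * ga + ga^*) * ka + p1
  /\ D (@sc_alpha R) - delb (@sc_epsilon R) =
       (ro + ep^* - 2 * ep) * al + be * si^* - be^* * ep - ka * la
       - ka^* * ga + (ep + ro) * pi
  /\ D (@sc_beta R) - del (@sc_epsilon R) =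
       (al + pi) * si + (ro^* - ep^*) * be - (mu + ga) * ka
       - (al^* - pi^*) * ep + p1
  /\ D (@sc_gamma R) - Del (@sc_epsilon R) =
       (ta + pi^*) * al + (ta^* + pi) * be - (ep + ep^*) * ga
       - (ga + ga^*) * ep + ta * pi - nu * ka + p2
  /\ D (@sc_lambda R) - delb (@sc_pi R) =
       (ro * la + si^* * mu) + pi ^+ 2 + (al - be^*) * pi - nu * ka^*
       - (3 * ep - ep^*) * la
  /\ D (@sc_mu R) - del (@sc_pi R) =
       (ro^* * mu + si * la) + pi * pi^* - (ep + ep^*) * mu
       - pi * (al^* - be) - ka * nu + p2
  /\ D (@sc_nu R) - Del (@sc_pi R) =
       (pi + ta^*) * mu + (pi^* + ta) * la + (ga - ga^*) * pi
       - (3 * ep + ep^*) * nu + p3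
  /\ Del (@sc_lambda R) - delb (@sc_nu R) =
       - (mu + mu^*) * la - (3 * ga - ga^*) * la
       + (3 * al + be^* + pi - ta^*) * nu - p4
  /\ del (@sc_rho R) - delb (@sc_sigma R) =
       ro * (al^* + be) - si * (3 * al - be^*) + (ro - ro^*) * ta
       + (mu - mu^*) * ka - p1
  /\ del (@sc_alpha R) - delb (@sc_beta R) =
       (mu * ro - la * si) + al * al^* + be * be^* - 2 * al * be
       + ga * (ro - ro^*) + ep * (mu - mu^*) - p2
  /\ del (@sc_lambda R) - delb (@sc_mu R) =
       (ro - ro^*) * nu + (mu - mu^*) * pi + mu * (al + be^*)
       + la * (al^* - 3 * be) - p3
  /\ del (@sc_nu R) - Del (@sc_mu R) =
       (mu ^+ 2 + la * la^*) + (ga + ga^*) * mu - nu^* * pi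
       + (ta - 3 * be - al^*) * nu
  /\ del (@sc_gamma R) - Del (@sc_beta R) =
       (ta - al^* - be) * ga + mu * ta - si * nu - ep * nu^*
       - be * (ga - ga^* - mu) + al * la^*
  /\ del (@sc_tau R) - Del (@sc_sigma R) =
       (mu * si + la^* * ro) + (ta + be - al^*) * ta
       - (3 * ga - ga^*) * si - ka * nu^*
  /\ Del (@sc_rho R) - delb (@sc_tau R) =
       - (ro * mu^* + si * la) + (be^* - al - ta^*) * ta
       + (ga + ga^*) * ro + nu * ka - p2
  /\ Del (@sc_alpha R) - delb (@sc_gamma R) =
       (ro + ep) * nu - (ta + be) * la + (ga^* - mu^*) * al
       + (be^* - ta^*) * ga - p3.

Definition np_bianchi e G W x : Prop :=
  let D p := dd (vec_l (e x)) (fun y => p (W y)) x in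
  let Del p := dd (vec_n (e x)) (fun y => p (W y)) x in
  let del p := dd (vec_m (e x)) (fun y => p (W y)) x in
  let delb p := dd (vec_mb (e x)) (fun y => p (W y)) x in
  let: Spin ka si ro ta ep be ga al pi mu la nu := G x in
  let: Weyl p0 p1 p2 p3 p4 := W x in
     delb (@Psi0 R) - D (@Psi1 R) =
       (4 * al - pi) * p0 - 2 * (2 * ro + ep) * p1 + 3 * ka * p2
  /\ Del (@Psi0 R) - del (@Psi1 R) =
       (4 * ga - mu) * p0 - 2 * (2 * ta + be) * p1 + 3 * si * p2
  /\ delb (@Psi1 R) - D (@Psi2 R) =
       la * p0 + 2 * (al - pi) * p1 - 3 * ro * p2 + 2 * ka * p3
  /\ Del (@Psi1 R) - del (@Psi2 R) =
       nu * p0 + 2 * (ga - mu) * p1 - 3 * ta * p2 + 2 * si * p3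
  /\ delb (@Psi2 R) - D (@Psi3 R) =
       2 * la * p1 - 3 * pi * p2 + 2 * (ep - ro) * p3 + ka * p4
  /\ Del (@Psi2 R) - del (@Psi3 R) =
       2 * nu * p1 - 3 * mu * p2 + 2 * (be - ta) * p3 + si * p4
  /\ delb (@Psi3 R) - D (@Psi4 R) =
       3 * la * p2 - 2 * (al + 2 * pi) * p3 + (4 * ep - ro) * p4
  /\ Del (@Psi3 R) - del (@Psi4 R) =
       3 * nu * p2 - 2 * (ga + 2 * mu) * p3 + (4 * be - ta) * p4.

Definition vacuum_np_equations U e G W : Prop :=
  forall x, U x ->
    [/\ np_commutators e G x, np_ricci e G W x & np_bianchi e G W x].

(* Unknowns; for the frame there is one column (C^A, P^A, Q) for each A. *)
Definition unk1 f (A : 'I_2) : 'cV[R[i]]_3 :=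
  \col_(j < 3) [:: (fC f A)%:C; fP f A; (fQ f)%:C]`_j.
Definition unk2 (s : spin R) : 'cV[R[i]]_9 :=
  \col_(j < 9) [:: sc_epsilon s; sc_pi s; sc_beta s; sc_mu s; sc_alpha s;
                   sc_lambda s; sc_tau s; sc_sigma s; sc_rho s]`_j.
Definition unk3 (w : weyl R) : 'cV[R[i]]_5 := \col_(j < 5) (weyl_seq w)`_j.

Definition D1 f : opmx R 3 :=
  let D := vec_l f in let Del := vec_n f in
  diag_mx (\row_(j < 3) [:: Del; Del; D]`_j).
Definition D2 f : opmx R 9 :=
  let D := vec_l f in let Del := vec_n f in
  diag_mx (\row_(j < 9) [:: Del; Del; Del; Del; Del; Del; D; D; D]`_j).
Definition D3 f : opmx R 5 :=
  let D := vec_l f in let Del := vec_n f in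
  let del := vec_m f in let delb := vec_mb f in
  \matrix_(j < 5, k < 5)
    (nth [::]
       [:: [:: Del;   - del;   0;       0;       0];
           [:: - delb; D + Del; - del;   0;       0];
           [:: 0;     - delb;  D + Del; - del;   0];
           [:: 0;     0;       - delb;  D + Del; - del];
           [:: 0;     0;       0;       - delb;  D]] j)`_k.

(* Right-hand sides: functions of the values of the unknowns (and of their
   complex conjugates), not of their derivatives. *)
Definition rhs1 f (s : spin R) (A : 'I_2) : 'cV[R[i]]_3 :=
  let: Spin ka si ro ta ep be ga al pi mu la nu := s in
  let P := fP f A in
  \col_(j < 3)
    [:: - (ta^* + pi) * P - (ta + pi^*) * P^*;
        - mu * P - la^* * P^*;
        - (ep + ep^*) * (fQ f)%:C]`_j.

Definition rhs2 (s : spin R) (w : weyl R) : 'cV[R[i]]_9 :=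
  let: Spin ka si ro ta ep be ga al pi mu la nu := s in
  let: Weyl p0 p1 p2 p3 p4 := w in
  \col_(j < 9)
    [:: - p2 - be * pi - al * pi^* - al * ta - pi * ta - be * ta^*;
        - p3 - mu * pi - la * pi^* - la * ta - mu * ta^*;
        - al * la^* - be * mu - mu * ta;
        - la * la^* - mu ^+ 2;
        - p3 - be * la - al * mu - la * ta;
        - p4 - 2 * la * mu;
        p1 + pi^* * ro + pi * si + (ep - ep^* + ro) * ta + si * ta^*;
        p0 + (3 * ep - ep^* + 2 * ro) * si;
        (ep + ep^*) * ro + ro ^+ 2 + si * si^*]`_j.

Definition rhs3 (s : spin R) (w : weyl R) : 'cV[R[i]]_5 :=
  let: Spin ka si ro ta ep be ga al pi mu la nu := s in
  let: Weyl p0 p1 p2 p3 p4 := w in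
  \col_(j < 5)
    [:: - mu * p0 - 2 * (2 * ta + be) * p1 + 3 * si * p2;
        (pi - 4 * al) * p0 + 2 * (2 * ro + ep - mu) * p1 - 3 * ta * p2
          + 2 * si * p3;
        - la * p0 + 2 * (pi - al) * p1 + 3 * (ro - mu) * p2
          + 2 * (be - ta) * p3 + si * p4;
        - 2 * la * p1 + 3 * pi * p2 + 2 * (ro - ep - 2 * mu) * p3
          + (4 * be - ta) * p4;
        - 3 * la * p2 + 2 * (2 * pi + al) * p3 + (ro - 4 * ep) * p4]`_j.

Definition evolution_system U e G W : Prop :=
  forall x, U x ->
    [/\ forall A, opact (D1 (e x)) (fun y => unk1 (e y) A) x
                  = rhs1 (e x) (G x) A,
        opact (D2 (e x)) (fun y => unk2 (G y)) x = rhs2 (G x) (W x) &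
        opact (D3 (e x)) (fun y => unk3 (W y)) x = rhs3 (G x) (W x)].

End StewartGauge.

(* Main.v *)
(* The covector of l + n takes the value 1 on l and on n and 0 on m and its
   conjugate, so the symbols of the three operators in that direction are the
   diagonal matrices 1, 1 and diag(1, 2, 2, 2, 1). The evolution equations are
   Newman-Penrose equations in which the derivatives of kappa, nu and gamma
   vanish because these coefficients are zero on an open set; the middle three
   Weyl equations are differences of two Bianchi identities. *)
Require Import Defs.
From HB Require Import structures.
From mathcomp Require Import all_boot all_order all_algebra.
From mathcomp Require Import complex ring.
From mathcomp Require Import all_classical all_reals all_analysis.
Import Order.TTheory GRing.Theory Num.Theory.
Import numFieldNormedType.Exports.
Local Open Scope ring_scope.

Set Implicit Arguments.
Unset Strict Implicit.

(** * Derivatives along vectors, and locally constant functions *)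

Section DirectionalDerivatives.
Variable R : realType.
Implicit Types (f : coords R -> R[i]) (X Y : 'rV[R[i]]_4) (x : coords R).

Lemma ddD X Y f x : dd (X + Y) f x = dd X f x + dd Y f x.
Proof. by rewrite -big_split; apply: eq_bigr => i _; rewrite mxE mulrDl. Qed.

Lemma ddN X f x : dd (- X) f x = - dd X f x.
Proof. by rewrite -sumrN; apply: eq_bigr => i _; rewrite mxE mulNr. Qed.

Lemma dd0 f x : dd 0 f x = 0.
Proof. by apply: big1 => i _; rewrite mxE mul0r. Qed.

(** Partial derivatives see only the germ of [f] at [x], and openness of [U] makes [f] constant near
    [x]. Gauge conditions on [U] thus become vanishing derivatives. *)
Lemma dd_locally_cst (U : set (coords R)) X f (c : R[i]) x :
  open U -> U x -> (forall y, U y -> f y = c) -> dd X f x = 0.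
Proof.
move=> openU Ux fU; apply: big1 => mu _.
have nearU : \forall y \near x, U y by apply: open_nbhs_nbhs.
(* [h] stands for the real or the imaginary part, so both halves of [pd] are covered. *)
have deriv0 (h : R[i] -> R) : 'D_(delta_mx 0 mu) (fun y => h (f y)) x = 0.
  rewrite -[RHS](derive_cst (h c : R^o) x (delta_mx 0 mu)).
  by apply: near_eq_derive; near do rewrite fU //.
by rewrite /pd !deriv0 mulr0.
Unshelve. all: by end_near. Qed.

Lemma opact_diag n (d : 'rV['rV[R[i]]_4]_n) (w : coords R -> 'cV[R[i]]_n) x j :
  opact (diag_mx d) w x j 0 = dd (d 0 j) (fun y => w y j 0) x.
Proof.
rewrite mxE (bigD1 j) //= big1 => [|k kj].
  by rewrite addr0 mxE eqxx mulr1n.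
by rewrite mxE eq_sym (negbTE kj) mulr0n dd0.
Qed.

End DirectionalDerivatives.

(** * Hermitian symbols and positive definiteness *)

Section SymmetricHyperbolic.
Variable R : realType.

Lemma hermsymmxP n (A : 'M[R[i]]_n) :
  (forall i j, A i j = conjc (A j i)) -> A \is hermsymmx.
Proof.
move=> hA; apply/is_hermitianmxP; apply/matrixP => i j.
by rewrite expr0 scale1r !mxE hA.
Qed.

(** The form is the sum of [d_j |z_j|^2]; a nonzero entry of [z] gives one strictly positive term
    among nonnegative ones. *)
Lemma positive_definite_diag n (d : 'rV[R[i]]_n) :
  (forall i, 0 < d 0 i) -> positive_definite (diag_mx d).
Proof.
move=> d_gt0 z z0.
have [i zi0] : exists i, z i 0 != 0.
  apply/existsP; apply: contraNT z0 => /existsPn z0; apply/eqP/matrixP => i j.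
  by rewrite ord1 mxE; apply/eqP/negPn/z0.
have -> : (map_mx (@conjc R) z^T *m diag_mx d *m z) 0 0
    = \sum_j d 0 j * `|z j 0| ^+ 2.
  rewrite mxE; apply: eq_bigr => j _.
  by rewrite mul_mx_diag !mxE normCK mulrAC mulrC [_^* * _]mulrC.
rewrite (bigD1 i) //= ltr_pwDl ?mulr_gt0 ?exprn_gt0 ?normr_gt0 //.
by apply: sumr_ge0 => j _; rewrite mulr_ge0 ?exprn_ge0 // ltW.
Qed.

(** Treating the entries of [M] as vectors handles all four coefficient matrices at once: conjugate
    symmetry of the entries makes each of them Hermitian, and pairing the entries with [t] gives the
    symbol. *)
Lemma symmetric_hyperbolic_diag_symbol n (M : opmx R n) (t : 'rV[R[i]]_4)
    (d : 'rV[R[i]]_n) :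
    (forall j k, M j k = conjv (M k j)) ->
    (forall j k, (t *m (M j k)^T) 0 0 = diag_mx d j k) ->
    (forall j, 0 < d 0 j) ->
  symmetric_hyperbolic M t.
Proof.
move=> M_herm M_diag d_gt0; split.
  by move=> mu; apply: hermsymmxP => i j; rewrite !mxE M_herm mxE.
suff -> : \sum_mu t 0 mu *: coefmx M mu = diag_mx d.
  exact: positive_definite_diag.
apply/matrixP => j k; rewrite -M_diag summxE mxE.
by apply: eq_bigr => mu _; rewrite !mxE.
Qed.

Lemma symmetric_hyperbolic_diag n (d : 'rV['rV[R[i]]_4]_n) (t : 'rV[R[i]]_4) :
    (forall j, conjv (d 0 j) = d 0 j) ->
    (forall j, (t *m (d 0 j)^T) 0 0 = 1) ->
  symmetric_hyperbolic (diag_mx d) t.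
Proof.
move=> d_real d_t.
apply: (@symmetric_hyperbolic_diag_symbol _ _ _ (const_mx 1)) => [j k|j k|j].
- rewrite !mxE eq_sym; case: eqP => [->|_]; first by rewrite !mulr1n d_real.
  by rewrite !mulr0n /conjv map_mx0.
- rewrite !(mxE diag_mx_key); case: eqP => [->|_].
    by rewrite !mulr1n d_t mxE.
  by rewrite !mulr0n trmx0 mulmx0 mxE.
- by rewrite mxE.
Qed.

End SymmetricHyperbolic.

(** * The three operators in the direction [l + n] *)

Section StewartTetrad.
Variables (R : realType) (h : 'M[R]_4) (f : frame R).

Lemma conjv_l : conjv (vec_l f) = vec_l f.
Proof.
by apply/rowP; case=> [[|[|[|[|//]]]] ?]; rewrite !mxE /= oppr0.
Qed.

Lemma conjv_n : conjv (vec_n f) = vec_n f.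
Proof.
by apply/rowP; case=> [[|[|[|[|//]]]] ?]; rewrite !mxE /= oppr0.
Qed.

Lemma gprodE X Y : gprod h X Y = (lower h X *m Y^T) 0 0.
Proof. by rewrite mxE; apply: eq_bigr => mu _; rewrite !mxE. Qed.

Hypothesis tetrad : stewart_tetrad h f.

Lemma lower_ln :
  lower h (vec_l f + vec_n f) = lower h (vec_l f) + lower h (vec_n f).
Proof.
apply/rowP => mu; rewrite !mxE -big_split; apply: eq_bigr => nu _.
by rewrite mxE mulrDr.
Qed.

(** The tetrad relations give each product in one order only; symmetry of the metric supplies
    g(n,l). *)
Lemma gprodC X Y : gprod h X Y = gprod h Y X.
Proof.
rewrite /gprod; under eq_bigr do rewrite mxE mulr_suml.
rewrite exchange_big; apply: eq_bigr => nu _; rewrite mxE mulr_suml.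
apply: eq_bigr => mu _.
rewrite -(Defs.metric_sym tetrad) mxE (Defs.metric_sym tetrad).
by rewrite mulrAC.
Qed.

Let t := lower h (vec_l f + vec_n f).

Lemma time_l : (t *m (vec_l f)^T) 0 0 = 1.
Proof.
rewrite /t lower_ln mulmxDl mxE -!gprodE (gprodC (vec_n f)).
by rewrite (g_ll tetrad) (g_ln tetrad) add0r.
Qed.

Lemma time_n : (t *m (vec_n f)^T) 0 0 = 1.
Proof.
by rewrite /t lower_ln mulmxDl mxE -!gprodE (g_nn tetrad) (g_ln tetrad) addr0.
Qed.

Lemma time_m : (t *m (vec_m f)^T) 0 0 = 0.
Proof.
by rewrite /t lower_ln mulmxDl mxE -!gprodE (g_lm tetrad) (g_nm tetrad) addr0.
Qed.

Lemma time_mb : (t *m (vec_mb f)^T) 0 0 = 0.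
Proof.
by rewrite /t lower_ln mulmxDl mxE -!gprodE (g_lmb tetrad) (g_nmb tetrad) addr0.
Qed.

Lemma symmetric_hyperbolic_ln n (d : 'rV['rV[R[i]]_4]_n) :
    (forall j, d 0 j = vec_l f \/ d 0 j = vec_n f) ->
  symmetric_hyperbolic (diag_mx d) t.
Proof.
by move=> d_ln; apply: symmetric_hyperbolic_diag => j; case: (d_ln j) => ->;
  rewrite ?conjv_l ?conjv_n ?time_l ?time_n.
Qed.

Lemma symmetric_hyperbolic_D1 : symmetric_hyperbolic (D1 f) t.
Proof.
by apply: symmetric_hyperbolic_ln; case=> [[|[|[|//]]] ?]; rewrite mxE /=; auto.
Qed.

Lemma symmetric_hyperbolic_D2 : symmetric_hyperbolic (D2 f) t.
Proof.
by apply: symmetric_hyperbolic_ln;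
  case=> [[|[|[|[|[|[|[|[|[|//]]]]]]]]] ?]; rewrite mxE /=; auto.
Qed.

(** Mirror entries off the diagonal are conjugate because [vec_mb] conjugates [vec_m], and [t]
    annihilates them because [l + n] is orthogonal to both. The diagonal entries are real
    vectors. *)
Lemma symmetric_hyperbolic_D3 : symmetric_hyperbolic (D3 f) t.
Proof.
have conjvN X : conjv (- X) = - conjv X by exact: map_mxN.
have conjvD X Y : conjv (X + Y) = conjv X + conjv Y by exact: map_mxD.
have conjv0 : conjv 0 = 0 :> 'rV[R[i]]_4 by exact: map_mx0.
have conjvK : conjv (vec_mb f) = vec_m f.
  by apply/rowP => mu; rewrite !mxE conjcK.
have timeD X Y : (t *m (X + Y)^T) 0 0 = (t *m X^T) 0 0 + (t *m Y^T) 0 0.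
  by rewrite linearD mulmxDr mxE.
have timeN X : (t *m (- X)^T) 0 0 = - (t *m X^T) 0 0.
  by rewrite linearN mulmxN mxE.
have time0 : (t *m (0 : 'rV_4)^T) 0 0 = 0 by rewrite trmx0 mulmx0 mxE.
apply: (@symmetric_hyperbolic_diag_symbol _ _ _ _
  (\row_(j < 5) [:: 1; 2; 2; 2; 1]`_j)) => [j k|j k|j].
- case: j => [[|[|[|[|[|//]]]]] ?]; case: k => [[|[|[|[|[|//]]]]] ?];
    rewrite !(mxE matrix_key) /=;
    by rewrite ?(conjvD, conjvN, conjv0, conjvK, conjv_l, conjv_n).
- case: j => [[|[|[|[|[|//]]]]] ?]; case: k => [[|[|[|[|[|//]]]]] ?];
    (* Unfolding is confined to the entry of [D3] and the list of diagonal values: the product with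
       [t] stays folded for the [time] equations. *)
    rewrite /D3 [X in X^T](mxE matrix_key) [RHS]mxE [(\row_i _) _ _]mxE /=;
    by rewrite ?(timeD, timeN, time0, time_l, time_n, time_m, time_mb) ?oppr0.
- by case: j => [[|[|[|[|[|//]]]]] ?]; rewrite mxE /= ?ltr01 ?ltr0n.
Qed.

End StewartTetrad.

(** * Angular components of the tetrad vectors *)

Section FrameComponents.
Variables (R : realType) (f : frame R).

(* The position of the coordinate x^A among (v, u, x^2, x^3). *)
Definition angular (A : 'I_2) : 'I_4 := lift 0 (lift 0 A).

Lemma vec_l_angular A : vec_l f 0 (angular A) = (fC f A)%:C%C.
Proof.
rewrite mxE; case: A => [[|[|//]] A2] /=; congr (fC f _)%:C%C; exact: val_inj.
Qed.

Lemma vec_n_angular A : vec_n f 0 (angular A) = 0.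
Proof. by rewrite mxE; case: A => [[|[|//]] A2]. Qed.

Lemma vec_m_angular A : vec_m f 0 (angular A) = fP f A.
Proof.
rewrite mxE; case: A => [[|[|//]] A2] /=; congr (fP f _); exact: val_inj.
Qed.

Lemma vec_mb_angular A : vec_mb f 0 (angular A) = (fP f A)^*.
Proof. by rewrite mxE vec_m_angular. Qed.

End FrameComponents.

(** * The evolution equations from the Newman-Penrose equations *)

Section Evolution.
Variables (R : realType) (U : set (coords R)) (g : coords R -> 'M[R]_4).
Variables (e : coords R -> frame R) (G : coords R -> spin R).
Variables (W : coords R -> weyl R).
Hypotheses (openU : open U) (gauge : stewart_gauge U g e G W).

(** Replaces components by closed forms under the derivative; a component that is identically zero
    then contributes the derivative of a constant. *)
Lemma lie_bracket_entry (X Y : frame R -> 'rV[R[i]]_4) (p q : frame R -> R[i])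
    nu x :
    (forall f, X f 0 nu = p f) -> (forall f, Y f 0 nu = q f) ->
  lie_bracket (fun y => X (e y)) (fun y => Y (e y)) x 0 nu =
  dd (X (e x)) (fun y => q (e y)) x - dd (Y (e x)) (fun y => p (e y)) x.
Proof.
move=> Xp Yq; rewrite mxE.
have -> : (fun y => X (e y) 0 nu) = (fun y => p (e y)) by apply/funext => y.
by have -> : (fun y => Y (e y) 0 nu) = (fun y => q (e y)) by apply/funext => y.
Qed.

Lemma dd_cst0 X (x : coords R) : dd X (fun=> 0) x = 0.
Proof. exact: (@dd_locally_cst _ setT _ _ 0 _ openT). Qed.

(** Reduces each evolution equation to a [ring] identity between differences of sides. Below, [esym]
    is applied to a source equation in which the derivative of the unknown carries a minus sign. *)
Lemma eq_of_subr (V : zmodType) (a b c d : V) : c = d -> a - b = c - d -> a = b.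
Proof. by move=> ->; rewrite subrr => /subr0_eq. Qed.

(** The angular components of [n,l] evolve [C], its u-component (index 1) evolves [Q], and the
    angular components of [m,n] evolve [P]. *)
Lemma evolution1 x A : U x -> np_commutators e G x ->
  opact (D1 (e x)) (fun y => unk1 (e y) A) x = rhs1 (e x) (G x) A.
Proof.
move=> Ux; have [] := gauge_spin gauge Ux; rewrite /np_commutators /rhs1.
case: (G x) => ka si ro ta ep be ga al pi mu la nu /=.
move=> ka0 nu0 ga0 ro_real mu_real _ [nl _ mn _].
have {nl} nl i := congr1 (fun v : 'rV_4 => v 0 i) nl.
have {mn} mn i := congr1 (fun v : 'rV_4 => v 0 i) mn.
(* With abstract vectors the expansion leaves tetrad entries folded, ready for the component
   lemmas. *)
have combE (a b c d : R[i]) (u v w z : 'rV[R[i]]_4) i :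
    (a *: u + b *: v + c *: w + d *: z) 0 i =
    a * u 0 i + b * v 0 i + c * w 0 i + d * z 0 i.
  by rewrite !mxE.
have combBE (a b c d : R[i]) (u v w z : 'rV[R[i]]_4) i :
    (a *: u + b *: v - c *: w - d *: z) 0 i =
    a * u 0 i + b * v 0 i - c * w 0 i - d * z 0 i.
  by rewrite !mxE.
have n1 (f : frame R) : vec_n f 0 1 = (fQ f)%:C%C by rewrite mxE.
have l1 (f : frame R) : vec_l f 0 1 = 0 by rewrite mxE.
have m1 (f : frame R) : vec_m f 0 1 = 0 by rewrite mxE.
have mb1 (f : frame R) : vec_mb f 0 1 = 0 by rewrite mxE m1 conjc0.
have := etrans (nl (angular A)) (combBE _ _ _ _ _ _ _ _ _).
rewrite (lie_bracket_entry x (@vec_n_angular R ^~ A)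
  (@vec_l_angular R ^~ A)).
rewrite dd_cst0 vec_l_angular vec_n_angular vec_m_angular vec_mb_angular.
move=> eq_C.
have := etrans (nl 1) (combBE _ _ _ _ _ _ _ _ _).
rewrite (lie_bracket_entry x n1 l1) dd_cst0 l1 n1 m1 mb1 => eq_Q.
have := etrans (mn (angular A)) (combE _ _ _ _ _ _ _ _ _).
rewrite (lie_bracket_entry x (@vec_m_angular R ^~ A)
  (@vec_n_angular R ^~ A)).
rewrite dd_cst0 vec_l_angular vec_n_angular vec_m_angular vec_mb_angular.
move=> eq_P.
rewrite nu0 ga0 !conjC0 in eq_P; rewrite ga0 conjC0 in eq_C eq_Q.
apply/colP => j; rewrite opact_diag.
have -> : (fun y => unk1 (e y) A j 0)
    = (fun y => [:: (fC (e y) A)%:C; fP (e y) A; (fQ (e y))%:C]`_j)%C.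
  by apply/funext => y; rewrite mxE.
rewrite [RHS]mxE [X in dd X]mxE.
case: j => [[|[|[|//]]] ?] /=.
- by apply: (eq_of_subr eq_C); ring.
- by apply: (eq_of_subr (esym eq_P)); ring.
- by apply: (eq_of_subr (esym eq_Q)); ring.
Qed.

(** The nine Ricci equations kept are those pairing the derivative of one unknown along [l] or [n]
    with a derivative of kappa, nu or gamma. *)
Lemma evolution2 x : U x -> np_ricci e G W x ->
  opact (D2 (e x)) (fun y => unk2 (G y)) x = rhs2 (G x) (W x).
Proof.
move=> Ux.
have dd_kappa X : dd X (fun y => sc_kappa (G y)) x = 0.
  apply: (@dd_locally_cst _ _ _ _ 0 _ openU Ux) => y Uy.
  exact: kappa0 (gauge_spin gauge Uy).
have dd_nu X : dd X (fun y => sc_nu (G y)) x = 0.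
  apply: (@dd_locally_cst _ _ _ _ 0 _ openU Ux) => y Uy.
  exact: nu0 (gauge_spin gauge Uy).
have dd_gamma X : dd X (fun y => sc_gamma (G y)) x = 0.
  apply: (@dd_locally_cst _ _ _ _ 0 _ openU Ux) => y Uy.
  exact: gamma0 (gauge_spin gauge Uy).
have [] := gauge_spin gauge Ux; rewrite /np_ricci /rhs2.
case: (G x) => ka si ro ta ep be ga al pi mu la nu.
case: (W x) => p0 p1 p2 p3 p4 /=.
rewrite !dd_kappa !dd_nu !dd_gamma.
(* Reality of [ro] and [mu] turns sums such as [ro + ro^*] into the doubled terms of the evolution
   system. *)
move=> -> -> -> ro_real mu_real _; rewrite -!ro_real -!mu_real !conjC0.
case=> Drho [Dsigma] [Dtau] [_] [_] [Depsilon] [_] [_] [Dpi] [Dlambda] [_] [_].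
case=> [_] [Dmu] [Dbeta] [_] [_ Dalpha].
apply/colP => j; rewrite opact_diag.
have -> : (fun y => unk2 (G y) j 0) = (fun y =>
    [:: sc_epsilon (G y); sc_pi (G y); sc_beta (G y); sc_mu (G y);
        sc_alpha (G y); sc_lambda (G y); sc_tau (G y); sc_sigma (G y);
        sc_rho (G y)]`_j).
  by apply/funext => y; rewrite mxE.
rewrite [RHS]mxE [X in dd X]mxE.
case: j => [[|[|[|[|[|[|[|[|[|//]]]]]]]]] ?] /=.
- by apply: (eq_of_subr (esym Depsilon)); ring.
- by apply: (eq_of_subr (esym Dpi)); ring.
- by apply: (eq_of_subr (esym Dbeta)); ring.
- by apply: (eq_of_subr (esym Dmu)); ring.
- by apply: (eq_of_subr Dalpha); ring.
- by apply: (eq_of_subr Dlambda); ring.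
- by apply: (eq_of_subr Dtau); ring.
- by apply: (eq_of_subr Dsigma); ring.
- by apply: (eq_of_subr Drho); ring.
Qed.

(** For k = 1, 2, 3, subtracting the identity with -D Psi_k from the one with Delta Psi_k puts
    [D + Del] on the diagonal between [- delb] and [- del]. The end rows are single identities, the
    last with its sign reversed. *)
Lemma evolution3 x : U x -> np_bianchi e G W x ->
  opact (D3 (e x)) (fun y => unk3 (W y)) x = rhs3 (G x) (W x).
Proof.
move=> Ux.
have opact3 j : opact (D3 (e x)) (fun y => unk3 (W y)) x j 0
    = \sum_k dd (D3 (e x) j k) (fun y => (weyl_seq (W y))`_k) x.
  rewrite mxE; apply: eq_bigr => k _.
  have -> // : (fun y => unk3 (W y) k 0) = (fun y => (weyl_seq (W y))`_k).
  by apply/funext => y; rewrite mxE.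
have [] := gauge_spin gauge Ux; rewrite /np_bianchi /rhs3.
case: (G x) => ka si ro ta ep be ga al pi mu la nu.
case: (W x) => p0 p1 p2 p3 p4 /=.
move=> -> -> -> _ _ _ [B1] [B2] [B3] [B4] [B5] [B6] [B7 B8].
apply/colP => j; rewrite opact3 [RHS]mxE !big_ord_recl big_ord0.
case: j => [[|[|[|[|[|//]]]]] ?]; rewrite !(mxE matrix_key) /=;
  rewrite ?(ddD, ddN, dd0).
- by apply: (eq_of_subr B2); ring.
- by apply: (eq_of_subr (congr2 (fun a b => a - b) B4 B1)); ring.
- by apply: (eq_of_subr (congr2 (fun a b => a - b) B6 B3)); ring.
- by apply: (eq_of_subr (congr2 (fun a b => a - b) B8 B5)); ring.
- by apply: (eq_of_subr (esym B7)); ring.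
Qed.

End Evolution.

Unset Implicit Arguments.
Set Strict Implicit.

Theorem lemma3 (R : realType) (U : set (coords R)) (g : coords R -> 'M[R]_4)
    (e : coords R -> frame R) (G : coords R -> spin R) (W : coords R -> weyl R)
    (openU : open U) (gauge : stewart_gauge U g e G W) :
  (vacuum_np_equations U e G W -> evolution_system U e G W) /\
  (forall x, U x ->
     let t := lower (g x) (vec_l (e x) + vec_n (e x)) in
     [/\ symmetric_hyperbolic (D1 (e x)) t,
         symmetric_hyperbolic (D2 (e x)) t &
         symmetric_hyperbolic (D3 (e x)) t]).
Proof.
split=> [np_eqs x Ux | x Ux t]; last first.
  have tetrad := gauge_tetrad gauge Ux.
  split; [exact: symmetric_hyperbolic_D1 | exact: symmetric_hyperbolic_D2
         | exact: symmetric_hyperbolic_D3].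
have [commutators ricci bianchi] := np_eqs x Ux.
split=> [A||]; first exact: (evolution1 gauge).
  exact: (evolution2 openU gauge).
exact: (evolution3 gauge).
Qed.
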